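(* Let $(M,F)$ be a three-dimensional Finsler manifold with a compatible Riemannian metric $\gamma$, let $p\in M$, and let $(u^1,u^2,u^3)$ be local coordinates around $p$ such that $\partial/\partial u^1,\partial/\partial u^2,\partial/\partial u^3$ form an orthonormal basis at $p$ with respect to $\gamma$. Then the compatibility equations at $p$ for the torsion components $T_{ab}^c=T_{ab}^c(p)$ can be written in the form (as equations holding at every nonzero $v\in T_pM$) $$\left\langle C\times G,\begin{pmatrix} -T_{12}^3+T_{13}^2+T_{23}^1\\ -2T_{13}^1\\ 2T_{12}^1 \end{pmatrix}\right\rangle = -2X_1^{h^*}F,$$ $$\left\langle C\times G,\begin{pmatrix} 2T_{23}^2\\ -T_{12}^3-T_{13}^2-T_{23}^1\\ 2T_{12}^2 \end{pmatrix}\right\rangle = -2X_2^{h^*}F,$$ $$\left\langle C\times G,\begin{pmatrix} 2T_{23}^3\\ -2T_{13}^3 \\ T_{12}^3+T_{13}^2-T_{23}^1 \end{pmatrix}\right\rangle = -2X_3^{h^*}F,$$ where $G:=\mathrm{grad}\,F\sim\left(\frac{\partial F}{\partial y^1},\frac{\partial F}{\partial y^2},\frac{\partial F}{\partial y^3}\right)$ and $C\sim(y^1,y^2,y^3)$.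
   Context: A Finsler function on a smooth manifold $M$ is a continuous $F\colon TM\to\mathbb{R}$, smooth off the zero section, with $F(tv)=tF(v)$ for $t>0$, such that the fibrewise Hessian of $E=F^2/2$ is positive definite at all nonzero $v$. Local coordinates $u^i$ on $M$ induce coordinates $x^i=u^i\circ\pi$, $y^i(v)=v(u^i)$ on $TM$, where $\pi\colon TM\to M$ is the projection. A linear connection $\nabla$ is compatible to $F$ if its parallel transports preserve $F$. A Riemannian metric $\gamma$ is compatible to $F$ if every linear connection compatible to $F$ is metrical with respect to $\gamma$. Let $\Gamma^{*k}_{ij}$ be the Christoffel symbols of the Lévi-Civita connection $\nabla^*$ of $\gamma$ and $X_i^{h^*}=\frac{\partial}{\partial x^i}-y^j\,\Gamma^{*k}_{ij}\circ\pi\,\frac{\partial}{\partial y^k}$ (summation over repeated indices). A linear connection $\nabla$, metrical with respect to $\gamma$, with torsion components $T_{ij}^k=-T_{ji}^k$ has connection parameters $\Gamma_{ij}^r=\Gamma_{ij}^{*r}-\frac12\left(T^{l}_{jk}\gamma^{kr}\gamma_{il}+T^{l}_{ik}\gamma^{kr}\gamma_{jl}-T_{ij}^r\right)$. The compatibility equations $\frac{\partial F}{\partial x^i}-y^j\Gamma^k_{ij}\circ\pi\frac{\partial F}{\partial y^k}=0$ thus become, at $p$, the linear system $$y^j(v)\left(T^{l}_{jk}\gamma^{kr}\gamma_{il}+T^{l}_{ik}\gamma^{kr}\gamma_{jl}-T_{ij}^r\right)(p)\frac{\partial F}{\partial y^r}(v)=-2X_i^{h^*}F(v),\quad i=1,2,3,\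 v\in T_pM\setminus\{0\},$$ for the components $T_{ab}^c(p)$, $a<b$; this is what is meant by ''the compatibility equations at $p$''. In the claim, $T_pM$ is identified with Euclidean $\mathbb{R}^3$ via the orthonormal coordinate basis, $\langle\cdot,\cdot\rangle=\gamma_p$ is the standard inner product, and $\times$ is the usual cross product. *)

(* Defs.v *)
From HB Require Import structures.
From mathcomp Require Import all_boot all_order all_algebra.
From mathcomp Require Import all_classical all_reals all_analysis.
Set Implicit Arguments.
Unset Strict Implicit.
Unset Printing Implicit Defensive.
Import Order.TTheory GRing.Theory Num.Theory.
Import numFieldNormedType.Exports.
Local Open Scope classical_set_scope.
Local Open Scope ring_scope.

(* Smooth maps between finite-dimensional normed spaces: all iterated
   directional derivatives exist and are continuous. In finite dimension this is
   the usual notion phrased with iterated partial derivatives. [O] is meant to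
   be open. *)
Fixpoint Ck_on (R : realType) (V W : normedModType R) (k : nat) (O : set V)
    (f : V -> W) : Prop :=
  (forall x, O x -> {for x, continuous f}) /\
  match k with
  | 0%N => True
  | k'.+1 => forall v : V, (forall x, O x -> derivable f x v) /\
                           Ck_on k' O ('D_v f)
  end.

Definition smooth_on (R : realType) (V W : normedModType R) (O : set V)
    (f : V -> W) : Prop :=
  forall k, Ck_on k O f.

Definition smooth_at (R : realType) (V W : normedModType R) (x : V)
    (f : V -> W) : Prop :=
  exists2 O : set V, open_nbhs x O & smooth_on O f.

(* [chart_fun] and [chart_inv] are total; their values outside [chart_dom] and
   its image carry no information. *)
Record chart (R : realType) (n : nat) (T : topologicalType) := Chart {
  chart_dom : set T;
  chart_fun :> T -> 'rV[R]_n;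
  chart_inv : 'rV[R]_n -> T;
  chart_dom_open : open chart_dom;
  chart_img_open : open (chart_fun @` chart_dom);
  chart_cont : forall p, chart_dom p -> {for p, continuous chart_fun};
  chart_inv_cont : forall x, (chart_fun @` chart_dom) x ->
    {for x, continuous chart_inv};
  chart_funK : forall p, chart_dom p -> chart_inv (chart_fun p) = p
}.

Definition chart_compatible (R : realType) (n : nat) (T : topologicalType)
    (c d : chart R n T) : Prop :=
  smooth_on (c @` (chart_dom c `&` chart_dom d)) (d \o chart_inv c) /\
  smooth_on (d @` (chart_dom c `&` chart_dom d)) (c \o chart_inv d).

Record smoothManifold (R : realType) (n : nat) := SmoothManifold {
  manifold_space :> topologicalType;
  atlas : set (chart R n manifold_space);
  manifold_hausdorff : hausdorff_space manifold_space;
  manifold_countable : @second_countable manifold_space;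
  atlas_cover : forall p : manifold_space, exists2 c, atlas c & chart_dom c p;
  atlas_compatible : forall c d, atlas c -> atlas d -> chart_compatible c d;
  atlas_maximal : forall c, (forall d, atlas d -> chart_compatible c d) -> atlas c
}.

Section Manifold.
Variables (R : realType) (n : nat) (M : smoothManifold R n).

Definition local_coordinates (p : M) (u : chart R n M) : Prop :=
  atlas u /\ chart_dom u p.

Definition coord (u : chart R n M) (i : 'I_n) : M -> R := fun q => u q 0 i.

Definition smooth_near (p : M) (f : M -> R) : Prop :=
  forall u, local_coordinates p u -> smooth_at (u p) (f \o chart_inv u).

(* Tangent vectors at p are the derivations of germs at p of smooth functions.
   A derivation is encoded as an operator on all functions [M -> R], set to 0 on
   the functions which are not smooth near p, so that tangent vectors with
   the same values on germs are equal. *)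
Definition operator : Type := (M -> R) -> R.

Definition tangent (p : M) : set operator := [set v |
  [/\ (forall f g, smooth_near p f -> smooth_near p g ->
         (\forall q \near p, f q = g q) -> v f = v g),
      (forall (a : R) f g, smooth_near p f -> smooth_near p g ->
         v (fun q => a * f q + g q) = a * v f + v g),
      (forall f g, smooth_near p f -> smooth_near p g ->
         v (fun q => f q * g q) = f p * v g + g p * v f) &
      (forall f, ~ smooth_near p f -> v f = 0)]].

Definition basis_vec (i : 'I_n) : 'rV[R]_n := delta_mx 0 i.

(* coord_vec u i q is the derivation d/du^i at q. *)
Definition coord_vec (u : chart R n M) (i : 'I_n) (q : M) : operator := fun f =>
  if `[< smooth_near q f >]
  then 'D_(basis_vec i) (f \o chart_inv u) (u q) else 0.

(* A possibly only locally defined vector field is represented by a total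
   function [M -> operator]; only its germ at p is constrained. *)
Definition vector_field_near (p : M) (X : M -> operator) : Prop :=
  (\forall q \near p, tangent q (X q)) /\
  (forall f, smooth_near p f -> smooth_near p (fun q => X q f)).

(* A function on the tangent bundle is a function F of a base point and an
   operator, of which only the values F q v with v tangent at q matter. *)

(* F in the coordinates (x^1,..,x^n,y^1,..,y^n) induced by u on TM. *)
Definition local_rep (u : chart R n M) (F : M -> operator -> R) :
    'rV[R]_n * 'rV[R]_n -> R :=
  fun xy => let q := chart_inv u xy.1 in
    F q (fun f => \sum_i xy.2 0 i * coord_vec u i q f).

Definition fibre_coord (u : chart R n M) (v : operator) : 'rV[R]_n :=
  \row_i v (coord u i).

Definition dFdx (u : chart R n M) (F : M -> operator -> R) (i : 'I_n)
    (p : M) (v : operator) : R :=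
  'D_(basis_vec i, 0) (local_rep u F) (u p, fibre_coord u v).

Definition dFdy (u : chart R n M) (F : M -> operator -> R) (i : 'I_n)
    (p : M) (v : operator) : R :=
  'D_(0, basis_vec i) (local_rep u F) (u p, fibre_coord u v).

Definition hessian (f : 'rV[R]_n -> R) (y : 'rV[R]_n) : 'M[R]_n :=
  \matrix_(i, j) 'D_(basis_vec i) ('D_(basis_vec j) f) y.

Definition posdef (A : 'M[R]_n) : Prop :=
  forall w : 'rV[R]_n, w != 0 -> 0 < (w *m A *m w^T) 0 0.

Definition finsler_function (F : M -> operator -> R) : Prop :=
  [/\ (forall u, atlas u -> forall xy : 'rV[R]_n * 'rV[R]_n,
         (u @` chart_dom u) xy.1 -> {for xy, continuous (local_rep u F)}),
      (forall u, atlas u ->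
         smooth_on [set xy : 'rV[R]_n * 'rV[R]_n |
                      (u @` chart_dom u) xy.1 /\ xy.2 != 0] (local_rep u F)),
      (forall p v (t : R), tangent p v -> 0 < t ->
         F p (fun f => t * v f) = t * F p v) &
      (forall u, atlas u -> forall x y : 'rV[R]_n,
         (u @` chart_dom u) x -> y != 0 ->
         posdef (hessian (fun z => local_rep u F (x, z) ^+ 2 / 2) y))].

Definition riemannian_metric (g : M -> operator -> operator -> R) : Prop :=
  [/\ (forall p v w, tangent p v -> tangent p w -> g p v w = g p w v),
      (forall p (a : R) v v' w, tangent p v -> tangent p v' -> tangent p w ->
         g p (fun f => a * v f + v' f) w = a * g p v w + g p v' w),
      (forall p v, tangent p v -> v <> (fun=> 0) -> 0 < g p v v) &
      (forall p X Y, vector_field_near p X -> vector_field_near p Y ->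
         smooth_near p (fun q => g q (X q) (Y q)))].

(* nabla p v Y is the covariant derivative at p of the local vector field Y in
   the direction v. *)
Definition linear_connection (nabla : M -> operator -> (M -> operator) -> operator)
    : Prop :=
  [/\ (forall p v Y, tangent p v -> vector_field_near p Y ->
         tangent p (nabla p v Y)) /\
      (forall p v Y Z, tangent p v ->
         vector_field_near p Y -> vector_field_near p Z ->
         (\forall q \near p, Y q = Z q) -> nabla p v Y = nabla p v Z),
      (forall p (a : R) v w Y, tangent p v -> tangent p w ->
         vector_field_near p Y ->
         nabla p (fun f => a * v f + w f) Y =
         (fun f => a * nabla p v Y f + nabla p w Y f)),
      (forall p v Y Z, tangent p v ->
         vector_field_near p Y -> vector_field_near p Z ->
         nabla p v (fun q f => Y q f + Z q f) =
         (fun f => nabla p v Y f + nabla p v Z f)),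
      (forall p v (h : M -> R) Y, tangent p v -> smooth_near p h ->
         vector_field_near p Y ->
         nabla p v (fun q f => h q * Y q f) =
         (fun f => v h * Y p f + h p * nabla p v Y f)) &
      (forall p X Y, vector_field_near p X -> vector_field_near p Y ->
         vector_field_near p (fun q => nabla q (X q) Y))].

(* christoffel nabla u i j k is the function Gamma_ij^k on the domain of u, i.e.
   the k-th component of the covariant derivative of d/du^j along d/du^i. *)
Definition christoffel (nabla : M -> operator -> (M -> operator) -> operator)
    (u : chart R n M) (i j k : 'I_n) (q : M) : R :=
  nabla q (coord_vec u i q) (coord_vec u j) (coord u k).

Definition smooth_curve (a b : R) (c : R -> M) : Prop :=
  forall t, a <= t <= b -> {for t, continuous c} /\
    (forall f, smooth_near (c t) f -> smooth_at t (f \o c)).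

(* V is a parallel vector field along c over [a, b]; c and V are also defined
   around the end points, so that the derivatives there are two-sided. *)
Definition parallel_along (nabla : M -> operator -> (M -> operator) -> operator)
    (a b : R) (c : R -> M) (V : R -> operator) : Prop :=
  forall t, a <= t <= b ->
    (\forall s \near t, tangent (c s) (V s)) /\
    (forall u, local_coordinates (c t) u -> forall k,
       is_derive t 1 (fun s => V s (coord u k))
         (- \sum_i \sum_j 'D_1 (coord u i \o c) t * V t (coord u j) *
              christoffel nabla u i j k (c t))).

Definition connection_compatible (F : M -> operator -> R)
    (nabla : M -> operator -> (M -> operator) -> operator) : Prop :=
  forall (a b : R) (c : R -> M) (V : R -> operator), a <= b ->
    smooth_curve a b c -> parallel_along nabla a b c V ->
    F (c b) (V b) = F (c a) (V a).

Definition metrical (g : M -> operator -> operator -> R)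
    (nabla : M -> operator -> (M -> operator) -> operator) : Prop :=
  forall p v Y Z, tangent p v ->
    vector_field_near p Y -> vector_field_near p Z ->
    v (fun q => g q (Y q) (Z q)) =
    g p (nabla p v Y) (Z p) + g p (Y p) (nabla p v Z).

Definition metric_compatible (F : M -> operator -> R)
    (g : M -> operator -> operator -> R) : Prop :=
  forall nabla, linear_connection nabla -> connection_compatible F nabla ->
    metrical g nabla.

Definition lie_bracket (X Y : M -> operator) (p : M) : operator :=
  fun f => X p (fun q => Y q f) - Y p (fun q => X q f).

Definition torsion (nabla : M -> operator -> (M -> operator) -> operator)
    (X Y : M -> operator) (p : M) : operator :=
  fun f => nabla p (X p) Y f - nabla p (Y p) X f - lie_bracket X Y p f.

Definition levi_civita (g : M -> operator -> operator -> R)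
    (nabla : M -> operator -> (M -> operator) -> operator) : Prop :=
  [/\ linear_connection nabla, metrical g nabla &
      forall p X Y, vector_field_near p X -> vector_field_near p Y ->
        forall f, smooth_near p f -> torsion nabla X Y p f = 0].

Definition gram (g : M -> operator -> operator -> R) (u : chart R n M) (p : M)
    : 'M[R]_n :=
  \matrix_(i, j) g p (coord_vec u i p) (coord_vec u j p).

(* X_i^{h*} F *)
Definition horizontal_derivative
    (nabla : M -> operator -> (M -> operator) -> operator)
    (u : chart R n M) (F : M -> operator -> R) (i : 'I_n) (p : M) (v : operator)
    : R :=
  dFdx u F i p v -
  \sum_j \sum_k v (coord u j) * christoffel nabla u i j k p * dFdy u F k p v.

(* The left-hand side of the i-th compatibility equation at v; T i j k stands
   for T_ij^k. *)
Definition compat_lhs (g : M -> operator -> operator -> R) (u : chart R n M)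
    (F : M -> operator -> R) (p : M) (T : 'I_n -> 'I_n -> 'I_n -> R)
    (i : 'I_n) (v : operator) : R :=
  \sum_j \sum_r v (coord u j) *
    (\sum_k \sum_l (T j k l * invmx (gram g u p) k r * gram g u p i l +
                    T i k l * invmx (gram g u p) k r * gram g u p j l)
     - T i j r) * dFdy u F r p v.

Definition compatibility_equations (g : M -> operator -> operator -> R)
    (nabla : M -> operator -> (M -> operator) -> operator) (u : chart R n M)
    (F : M -> operator -> R) (p : M) (T : 'I_n -> 'I_n -> 'I_n -> R) : Prop :=
  forall v, tangent p v -> v <> (fun=> 0) -> forall i : 'I_n,
    compat_lhs g u F p T i v = - 2 * horizontal_derivative nabla u F i p v.

Definition fibre_gradient (u : chart R n M) (F : M -> operator -> R)
    (p : M) (v : operator) : 'rV[R]_n :=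
  \row_r dFdy u F r p v.

End Manifold.

Definition i1 : 'I_3 := @Ordinal 3 0 isT.
Definition i2 : 'I_3 := @Ordinal 3 1 isT.
Definition i3 : 'I_3 := @Ordinal 3 2 isT.

Definition vec3 (R : realType) (a b c : R) : 'rV[R]_3 :=
  \row_(k < 3) [:: a; b; c]`_k.

Definition dot (R : realType) (n : nat) (a b : 'rV[R]_n) : R :=
  \sum_k a 0 k * b 0 k.

Definition cross (R : realType) (a b : 'rV[R]_3) : 'rV[R]_3 :=
  vec3 (a 0 i2 * b 0 i3 - a 0 i3 * b 0 i2)
       (a 0 i3 * b 0 i1 - a 0 i1 * b 0 i3)
       (a 0 i1 * b 0 i2 - a 0 i2 * b 0 i1).

(* Main.v *)
(* At p the Gram matrix is the identity, so the i-th left-hand side is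
   \sum_(j, r) y_j A_jr G_r with A_jr = T_jr^i + T_ir^j - T_ij^r. The matrix A
   is skew-symmetric in j and r, hence the bilinear form it defines is the
   inner product of C x G with the axial vector (A_23, A_31, A_12). *)
Require Import Defs.
From mathcomp Require Import all_boot all_order all_algebra.
From mathcomp Require Import all_classical all_reals all_analysis.
From mathcomp Require Import ring lra.
Import Order.TTheory GRing.Theory Num.Theory.
Import numFieldNormedType.Exports.
Local Open Scope classical_set_scope.
Local Open Scope ring_scope.

Lemma sum_ord3 (V : zmodType) (f : 'I_3 -> V) :
  \sum_i f i = f i1 + f i2 + f i3.
Proof.
rewrite !big_ord_recl big_ord0 addr0 addrA.
(* The indices left by [big_ord_recl] are iterated lifts of [ord0]; they match [i1], [i2], [i3] by
   value. *)
by congr (f _ + f _ + f _); apply: val_inj.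
Qed.

Lemma dot_vec3 (R : realType) (x : 'rV[R]_3) (a b c : R) :
  dot x (vec3 a b c) = x 0 i1 * a + x 0 i2 * b + x 0 i3 * c.
Proof. by rewrite /dot sum_ord3 !mxE. Qed.

Lemma crossE (R : realType) (x y : 'rV[R]_3) :
  [/\ cross x y 0 i1 = x 0 i2 * y 0 i3 - x 0 i3 * y 0 i2,
      cross x y 0 i2 = x 0 i3 * y 0 i1 - x 0 i1 * y 0 i3 &
      cross x y 0 i3 = x 0 i1 * y 0 i2 - x 0 i2 * y 0 i1].
Proof. by split; rewrite mxE. Qed.

(** The diagonal terms vanish and the others pair up as [A j r * (x_j y_r - x_r y_j)], whose second
    factors are cross product components up to sign. Taking [A i3 i1] rather than [A i1 i3] absorbs
    the sign of the middle one. *)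
Lemma sum_skew_cross (R : realType) (A : 'I_3 -> 'I_3 -> R) (x y : 'rV[R]_3) :
  (forall j r, A j r = - A r j) ->
  \sum_j \sum_r x 0 j * A j r * y 0 r =
  dot (cross x y) (vec3 (A i2 i3) (A i3 i1) (A i1 i2)).
Proof.
move=> skewA; have A0 j : A j j = 0 by have := skewA j j; lra.
have [c1 c2 c3] := crossE _ x y.
rewrite dot_vec3 c1 c2 c3 !sum_ord3 !A0.
by rewrite (skewA i1 i3) (skewA i2 i1) (skewA i3 i2); ring.
Qed.

(** In an orthonormal basis, raising and lowering indices amounts to multiplying by Kronecker
    deltas, which collapse the sums over [k] and [l]. *)
Lemma compat_lhs_orthonormal (R : realType) (n : nat) (M : smoothManifold R n)
    (g : M -> operator M -> operator M -> R) (u : chart R n M)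
    (F : M -> operator M -> R) (p : M) (T : 'I_n -> 'I_n -> 'I_n -> R)
    (i : 'I_n) (v : operator M) :
  gram g u p = 1%:M ->
  compat_lhs g u F p T i v =
  \sum_j \sum_r fibre_coord u v 0 j * (T j r i + T i r j - T i j r) *
    fibre_gradient u F p v 0 r.
Proof.
move=> gram1; rewrite /compat_lhs gram1 invmx1.
apply: eq_bigr => j _; apply: eq_bigr => r _; rewrite !mxE.
congr (_ * (_ - _) * _).
(* The inverse Gram entry keeps only [k = r]; then the Gram entries keep [l = i] in the first sum
   and [l = j] in the second. *)
rewrite (bigD1 r) //= [X in _ + X]big1 ?addr0; last first.
  by move=> k /negPf kr; apply: big1 => l _; rewrite !mxE kr mulr0n; ring.
rewrite big_split /= (bigD1 i) //= [X in _ + X + _]big1; last first.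
  by move=> l; rewrite eq_sym => /negPf li; rewrite !mxE li mulr0n mulr0.
rewrite (bigD1 j) //= [X in _ + (_ + X)]big1; last first.
  by move=> l; rewrite eq_sym => /negPf lj; rewrite !mxE lj mulr0n mulr0.
by rewrite !mxE !eqxx !mulr1n !mulr1 !addr0.
Qed.

Theorem theorem2 (R : realType) (M : smoothManifold R 3)
  (F : M -> operator M -> R) (hF : finsler_function F)
  (g : M -> operator M -> operator M -> R) (hg : riemannian_metric g)
  (hFg : metric_compatible F g)
  (nablaS : M -> operator M -> (M -> operator M) -> operator M)
  (hLC : levi_civita g nablaS)
  (p : M) (u : chart R 3 M) (hu : local_coordinates p u)
  (hortho : forall i j : 'I_3,
    g p (coord_vec u i p) (coord_vec u j p) = (i == j)%:R)
  (T : 'I_3 -> 'I_3 -> 'I_3 -> R)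
  (hT : forall i j k : 'I_3, T i j k = - T j i k) :
  let C := fibre_coord u in
  let G := fibre_gradient u F p in
  let a1 := vec3 (- T i1 i2 i3 + T i1 i3 i2 + T i2 i3 i1)
                 (- 2 * T i1 i3 i1)
                 (2 * T i1 i2 i1) in
  let a2 := vec3 (2 * T i2 i3 i2)
                 (- T i1 i2 i3 - T i1 i3 i2 - T i2 i3 i1)
                 (2 * T i1 i2 i2) in
  let a3 := vec3 (2 * T i2 i3 i3)
                 (- 2 * T i1 i3 i3)
                 (T i1 i2 i3 + T i1 i3 i2 - T i2 i3 i1) in
  (forall v, tangent p v -> v <> (fun=> 0) ->
     [/\ compat_lhs g u F p T i1 v = dot (cross (C v) (G v)) a1,
         compat_lhs g u F p T i2 v = dot (cross (C v) (G v)) a2 &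
         compat_lhs g u F p T i3 v = dot (cross (C v) (G v)) a3]) /\
  (compatibility_equations g nablaS u F p T <->
   forall v, tangent p v -> v <> (fun=> 0) ->
     [/\ dot (cross (C v) (G v)) a1 = - 2 * horizontal_derivative nablaS u F i1 p v,
         dot (cross (C v) (G v)) a2 = - 2 * horizontal_derivative nablaS u F i2 p v &
         dot (cross (C v) (G v)) a3 = - 2 * horizontal_derivative nablaS u F i3 p v]).
Proof.
move=> C G a1 a2 a3.
have gram1 : gram g u p = 1%:M.
  by apply/matrixP => i j; rewrite !mxE hortho.
have T0 i k : T i i k = 0 by have := hT i i k; lra.
(* The axial vector is computed once for a general [i]; the three vectors of the claim are its
   specialisations. *)
have lhsE v i : compat_lhs g u F p T i v = dot (cross (C v) (G v))
    (vec3 (T i2 i3 i + T i i3 i2 - T i i2 i3)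
          (T i3 i1 i + T i i1 i3 - T i i3 i1)
          (T i1 i2 i + T i i2 i1 - T i i1 i2)).
  rewrite compat_lhs_orthonormal // -/C -/G.
  rewrite (sum_skew_cross _ (fun j r => T j r i + T i r j - T i j r)) //.
  (* Exchanging [j] and [r] swaps the last two terms, which carry opposite signs; the first changes
     sign by skewness of the torsion. *)
  by move=> j r; rewrite (hT j r); ring.
have rewr v : [/\ compat_lhs g u F p T i1 v = dot (cross (C v) (G v)) a1,
    compat_lhs g u F p T i2 v = dot (cross (C v) (G v)) a2 &
    compat_lhs g u F p T i3 v = dot (cross (C v) (G v)) a3].
  (* For each [i], terms with equal lower indices drop out and the rest are brought to [T a b c]
     with [a < b]; coinciding terms produce the factors 2. *)
  by split; rewrite lhsE; congr (dot _ (vec3 _ _ _));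
    rewrite ?T0 ?(hT i2 i1) ?(hT i3 i1) ?(hT i3 i2); ring.
split=> [v _ _|]; first exact: rewr.
split=> [eqs v tv v0 | eqs v tv v0 i].
  by have [<- <- <-] := rewr v; split; apply: eqs.
have [e1 e2 e3] := eqs v tv v0; have [r1 r2 r3] := rewr v.
have [||] : [\/ i = i1, i = i2 | i = i3].
  case: i => [[|[|[|//]]] ?]; [apply: Or31|apply: Or32|apply: Or33];
  exact: val_inj.
- by move->; rewrite r1.
- by move->; rewrite r2.
- by move->; rewrite r3.
Qed.
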